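(* Let $k$ be an algebraically closed field of characteristic $p>0$, and let $\mathbf{a}=(a_1,\ldots,a_r)$ be a type of length $r$ (for $m=1$). Suppose there exists a good deformation datum $\omega$ of type $\mathbf{a}$ (for $m=1$). Then for every lift $\mathbf{A}=(A_1,\ldots,A_r)$ of $\mathbf{a}$ we have \[ k_{\mathbf{A}}\cdot\min(r-1,p)\leq n_{\mathbf{A}}, \] where \[ n_{\mathbf{A}}:=\sum_{i=1}^r\max(A_i,0),\qquad k_{\mathbf{A}}:=\gcd(A_1,\ldots,A_r). \]
   Context: The following definitions are for the case $m=1$. A type of length $r$, where $r\geq 2$ is an integer with $h:=r-1\not\equiv 0\pmod p$, is a tuple $\mathbf{a}=(a_1,\ldots,a_r)$ with $a_i\in\mathbb{F}_p^\times$ and $\sum_i a_i=0$. A lift of $\mathbf{a}$ is a tuple $\mathbf{A}=(A_1,\ldots,A_r)\in\mathbb{Z}^r$ such that $A_i$ reduces to $a_i$ modulo $p$ for all $i$ and $\sum_{i=1}^r A_i=0$. A good deformation datum of type $\mathbf{a}$ is a differential form on $\mathbb{P}^1_k$ which, after a change of coordinate $z$, has the form $\omega=\sum_{i=1}^r\frac{a_i\,\mathrm{d}z}{z-z_i}$ with pairwise distinct $z_1,\ldots,z_r\in k$ (so $\omega$ is logarithmic, i.e. of the form $\mathrm{d}g/g$ with $g\in k(z)^\times$), and such that $\operatorname{ord}_\infty\omega=r-2$ and $\omega$ has no zero at any point other than $\infty$ (i.e. $\omega$ has a unique zero, located at $z=\infty$; for $r=2$ this means $\omega$ has no zeroes).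 *)

(* Defs.v *)
From mathcomp Require Import all_boot all_order all_algebra.

Set Implicit Arguments.
Unset Strict Implicit.
Unset Printing Implicit Defensive.

Import GRing.Theory.
Local Open Scope ring_scope.

(* A rational function f : {fraction {poly k}} in the coordinate z also stands
   for the differential form f dz on the projective line over k; a point of
   the projective line is an option k, with None for z = oo. *)

Section DifferentialForms.

Variable k : fieldType.

Definition rconst (c : k) : {fraction {poly k}} := FracField.tofrac c%:P.

Definition rvar : {fraction {poly k}} := FracField.tofrac 'X.

(* f(g(z)); meaningful when the denominator of f does not vanish at g,
   in particular for every nonconstant g. *)
Definition rcomp (f g : {fraction {poly k}}) : {fraction {poly k}} :=
  (map_poly rconst (\n_(repr f))).[g] / (map_poly rconst (\d_(repr f))).[g].

(* The form f(t) dt rewritten in the coordinate z, where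
   t = (al z + be) / (ga z + de), so dt = (al de - be ga) / (ga z + de)^2 dz. *)
Definition change_coord (al be ga de : k) (f : {fraction {poly k}}) :
    {fraction {poly k}} :=
  let num := rconst al * rvar + rconst be in
  let den := rconst ga * rvar + rconst de in
  rcomp f (num / den) * (rconst (al * de - be * ga) / den ^+ 2).

(* Order of vanishing of the nonzero form f dz at a point; the shift by -2
   at infinity is the double pole of dz there.  The fraction representing f
   need not be reduced.  The value for f = 0 is irrelevant. *)
Definition ord_form (x : option k) (f : {fraction {poly k}}) : int :=
  let n := \n_(repr f) in
  let d := \d_(repr f) in
  if x is Some c then (mup c n)%:Z - (mup c d)%:Z
  else (size d)%:Z - (size n)%:Z - 2.

End DifferentialForms.

Definition is_type (p r : nat) (a : 'I_r -> 'F_p) : Prop :=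
  [/\ (2 <= r)%N, ~~ (p %| r.-1)%N, forall i, a i != 0 & \sum_i a i = 0].

Definition is_lift (p r : nat) (a : 'I_r -> 'F_p) (A : 'I_r -> int) : Prop :=
  (forall i, (A i)%:~R = a i) /\ \sum_i A i = 0.

(* In characteristic p, (a i : nat)%:R is the image of a i under the
   embedding of the prime field 'F_p into k. *)
Definition log_form (k : fieldType) (p r : nat) (a : 'I_r -> 'F_p)
    (z : 'I_r -> k) : {fraction {poly k}} :=
  \sum_i rconst ((a i : nat)%:R : k) / (rvar k - rconst (z i)).

Definition good_deformation_datum (k : fieldType) (p r : nat)
    (a : 'I_r -> 'F_p) (omega : {fraction {poly k}}) : Prop :=
  exists al be ga de : k, al * de - be * ga != 0 /\
    let f := change_coord al be ga de omega in
    [/\ exists2 z : 'I_r -> k, injective z & f = log_form a z,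
        ord_form None f = r%:Z - 2
      & forall x : option k, x <> None -> ord_form x f <= 0].

Definition lift_n (r : nat) (A : 'I_r -> int) : int :=
  \sum_i Num.max (A i) 0.

Definition lift_k (r : nat) (A : 'I_r -> int) : int :=
  \big[gcdz/0]_i A i.

(* Main.v *)
(* In characteristic p, omega = c dz / prod (z - z_i) with c a nonzero constant,
   since the numerator can only vanish at infinity.  Put B = A / k_A and
   g = prod (z - z_i)^B_i = P / Q, so that k_A dg / g = omega and P, Q are monic
   of the same degree n = n_A / k_A.  Then
   k_A (P'Q - PQ') prod (z - z_i) = c P Q, so P'Q - PQ' has degree 2n - r.
   If n < p and d < n is the degree of D = P - Q, the coefficient of degree
   n + d - 1 of P'Q - PQ' = D'Q - DQ' is (d - n) lead(D), which does not vanish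
   in characteristic p; hence n + d - 1 <= 2n - r and r - 1 <= n. *)

Require Import Defs.
From mathcomp Require Import all_boot all_order all_algebra.
From mathcomp Require Import ring zify.

Import Order.TTheory GRing.Theory Num.Theory.

Local Open Scope ring_scope.

Lemma coefM_top (R : nzRingType) (p q : {poly R}) (m n : nat) :
  (size p <= m.+1)%N -> (size q <= n.+1)%N -> (p * q)`_(m + n) = p`_m * q`_n.
Proof.
move=> sp sq.
have lt_m : (m < (m + n).+1)%N by rewrite ltnS leq_addr.
rewrite coefM (bigD1 (Ordinal lt_m)) //= addKn big1 ?addr0 // => i.
rewrite -val_eqE /= neq_ltn => /orP[lt_im | lt_mi].
  by rewrite [q`__]nth_default ?mulr0 // (leq_trans sq) //; lia.
by rewrite nth_default ?mul0r // (leq_trans sp).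
Qed.

Lemma coefX_deriv (R : nzRingType) (p : {poly R}) (i : nat) :
  ('X * p^`())`_i = p`_i *+ i.
Proof. by rewrite coefXM coef_deriv; case: i. Qed.

Lemma size_wronskian_monic (k : fieldType) (p : nat) (P Q : {poly k}) (n : nat) :
  p \in [pchar k] -> P \is monic -> Q \is monic ->
  size P = n.+1 -> size Q = n.+1 -> (n < p)%N -> P != Q ->
  (n <= size (P^`() * Q - P * Q^`())%R)%N.
Proof.
move=> pchark monP monQ szP szQ ltnp neqPQ.
pose D := P - Q; set W := _ - _.
have D0 : D != 0 by rewrite subr_eq0.
have [d szD] : exists d, size D = d.+1.
  by exists (size D).-1; rewrite prednK // size_poly_gt0.
have ltdn : (d < n)%N.
  rewrite -szD; apply/leq_sizeP => j; rewrite leq_eqVlt => /orP[/eqP <-|ltnj].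
    have := monicP monP; have := monicP monQ.
    by rewrite !lead_coefE szP szQ /= coefB => -> ->; rewrite subrr.
  by rewrite coefB !nth_default ?subrr ?szP ?szQ.
have sizeXD (f : {poly k}) m : size f = m.+1 -> (size ('X * f^`())%R <= m.+1)%N.
  move=> szf; apply/leq_sizeP => j lemj.
  by rewrite coefX_deriv nth_default ?mul0rn // szf.
(* The factor 'X makes the coefficient computation uniform in the case d = 0,
   where D' = 0. *)
have WD : 'X * W = 'X * D^`() * Q - D * ('X * Q^`()).
  by rewrite /W /D derivB; ring.
have : ('X * W)`_(d + n) = - (D`_d *+ (n - d)).
  have Qn : Q`_n = 1 by have := monicP monQ; rewrite lead_coefE szQ.
  rewrite WD coefB !coefM_top ?sizeXD ?szD ?szQ // !coefX_deriv Qn mulr1.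
  by rewrite mulr_natr mulrnBr ?opprB // ltnW.
(* The factor [n - d] lies strictly between 0 and [p], so it is nonzero in [k]. *)
have nz : D`_d *+ (n - d) != 0.
  rewrite -mulr_natr mulf_neq0 //.
    by have := D0; rewrite -lead_coef_eq0 lead_coefE szD.
  by rewrite -(dvdn_pcharf pchark) gtnNdvd // ?subn_gt0 //; lia.
(* Cancelling ['X] puts the nonzero coefficient at index [d + n - 1], so [W] has size at least
   [d + n]; [d] is unknown, and only [n] is kept. *)
rewrite coefXM; case: eqP => [|_ Wdn]; first by lia.
have lt_size : ((d + n).-1 < size W)%N.
  rewrite ltnNge; apply/negP => /(nth_default 0); rewrite Wdn => /eqP.
  by rewrite oppr_eq0 (negbTE nz).
by apply: leq_trans lt_size; lia.
Qed.

Section SimplePoles.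

Variables (k : fieldType) (r : nat) (z : 'I_r -> k).

Definition pole_poly : {poly k} := \prod_i ('X - (z i)%:P).

(** The numerator of the sum of the [c i / (X - z i)] over the common denominator [pole_poly]. *)
Definition residue_poly (c : 'I_r -> k) : {poly k} :=
  \sum_i c i *: \prod_(j | j != i) ('X - (z j)%:P).

Definition node_poly (e : 'I_r -> nat) : {poly k} :=
  \prod_i ('X - (z i)%:P) ^+ e i.

Lemma monic_node_poly e : node_poly e \is monic.
Proof. by apply: monic_prod => i _; rewrite monic_exp ?monicXsubC. Qed.

Lemma size_node_poly e : size (node_poly e) = (\sum_i e i).+1.
Proof.
rewrite /node_poly; elim/big_rec2: _ => [|i f n _ szn].
  by rewrite size_poly1.
rewrite size_mul ?expf_neq0 ?polyXsubC_eq0 //; last by rewrite -size_poly_gt0 szn.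
by rewrite size_exp_XsubC szn addSn addnS.
Qed.

Lemma size_pole_poly : size pole_poly = r.+1.
Proof. by rewrite size_prod_XsubC /index_enum -enumT size_enum_ord. Qed.

(** Logarithmic differentiation, cleared of denominators. The induction runs over the factors of
    [node_poly] while [pole_poly] stays whole. *)
Lemma deriv_node_poly e :
  (node_poly e)^`() * pole_poly = node_poly e * residue_poly (fun i => (e i)%:R).
Proof.
rewrite /node_poly /residue_poly.
elim/big_rec2: _ => [|i L f _ IH]; first by rewrite derivC mul0r mulr0.
rewrite derivM mulrDl -(mulrA _ f^`()) IH deriv_exp derivXsubC mul1r.
(* The derivative of a power has the truncated exponent [(e i).-1], so exponent 0 is treated
   apart. *)
rewrite /pole_poly (bigD1 i) //=; case: (e i) => [|m] /=.
  by rewrite scale0r add0r expr0 mulr0n !mul0r add0r !mul1r.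
rewrite exprS -mul_polyC polyC_natr -mulr_natr; ring.
Qed.

Lemma tofrac_residue_poly (c : 'I_r -> k) :
  (\sum_i rconst (c i) / (rvar k - rconst (z i))) * FracField.tofrac pole_poly
  = FracField.tofrac (residue_poly c).
Proof.
rewrite mulr_suml [RHS]rmorph_sum /=; apply: eq_bigr => i _.
rewrite /rconst /rvar -tofracB /pole_poly (bigD1 i) //= tofracM mulrA divfK.
  by rewrite -tofracM mul_polyC.
by rewrite tofrac_eq0 polyXsubC_eq0.
Qed.

Lemma residue_poly_pole (c : 'I_r -> k) i : injective z ->
  c i != 0 -> ~~ root (residue_poly c) (z i).
Proof.
move=> inj_z ci; rewrite /root /residue_poly horner_sum (bigD1 i) //=.
rewrite [X in _ + X]big1 ?addr0.
  rewrite hornerZ mulf_neq0 // horner_prod prodf_seq_neq0.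
  apply/allP => j _; apply/implyP => neqji.
  by rewrite hornerXsubC subr_eq0 (inj_eq inj_z) eq_sym.
move=> j neqji; rewrite hornerZ horner_prod (bigD1 i) 1?eq_sym //=.
by rewrite hornerXsubC subrr mul0r mulr0.
Qed.

End SimplePoles.

Arguments pole_poly {k r} z.
Arguments residue_poly {k r} z c.
Arguments node_poly {k r} z e.

Lemma tofrac_num_repr (R : idomainType) (x : {fraction R}) :
  FracField.tofrac \n_(repr x) = x * FracField.tofrac \d_(repr x).
Proof.
rewrite -{2}[x]reprK; unlock FracField.tofrac; rewrite -[RHS]FracField.pi_mul.
apply/eqmodP; rewrite /= FracField.equivfE /FracField.mulf.
rewrite !numden_Ratio ?mulf_neq0 ?oner_neq0 ?denom_ratioP //.
by rewrite !mulr1 mul1r mulrC.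
Qed.

(** The representative read by [ord_form] may be unreduced; cross-multiplying with [N / R] shows
    that its common factors cancel in the difference of multiplicities. *)
Lemma ord_form_numerator (k : fieldType) (f : {fraction {poly k}})
    (N R : {poly k}) (x : k) :
  f * FracField.tofrac R = FracField.tofrac N -> N != 0 -> ~~ root R x ->
  ord_form (Some x) f = (mup x N)%:Z.
Proof.
move=> fRN N0 Rx; rewrite /ord_form.
set n := \n_(repr f); set d := \d_(repr f).
have d0 : d != 0 by apply: denom_ratioP.
have nRNd : n * R = N * d.
  apply/eqP; rewrite -tofrac_eq !tofracM tofrac_num_repr -fRN; apply/eqP.
  ring.
have := congr1 (mup x) nRNd; rewrite (mupMl n Rx) mupM // => ->; lia.
Qed.

(** A nonconstant numerator has a root in the closed field [k]. Nonzero residues keep that root away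
    from the poles, so the form would have a finite zero there. *)
Lemma residue_poly_const (k : closedFieldType) (p r : nat) (a : 'I_r -> 'F_p)
    (z : 'I_r -> k) :
  (0 < r)%N -> injective z -> (forall i, ((a i : nat)%:R : k) != 0) ->
  (forall x, x <> None -> ord_form x (log_form a z) <= 0) ->
  size (residue_poly z (fun i => (a i : nat)%:R)) = 1%N.
Proof.
move=> r0 inj_z nz_a ord_le0.
set N := residue_poly _ _.
have Nz i : ~~ root N (z i) by apply: residue_poly_pole.
have N0 : N != 0.
  by apply: contraNneq (Nz (Ordinal r0)) => ->; rewrite root0.
apply/eqP; apply/negPn/negP => /closed_rootP[x Nx].
have Rx : ~~ root (pole_poly z) x.
  apply: contraL Nx; rewrite /root horner_prod => /prodf_eq0[i _].
  by rewrite hornerXsubC subr_eq0 => /eqP ->; apply: Nz.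
have /ord_le0 : Some x <> None by [].
rewrite (@ord_form_numerator _ _ N (pole_poly z)) ?tofrac_residue_poly //.
by rewrite lez_nat leqNgt -XsubC_dvd // dvdp_XsubCl Nx.
Qed.

(** This is P'/P - Q'/Q, the logarithmic derivative of P/Q, cleared of denominators. *)
Lemma wronskian_node_poly (k : fieldType) (r : nat) (z : 'I_r -> k)
    (e f : 'I_r -> nat) :
  let P := node_poly z e in let Q := node_poly z f in
  (P^`() * Q - P * Q^`()) * pole_poly z
  = P * Q * residue_poly z (fun i => (e i)%:R - (f i)%:R).
Proof.
move=> P Q.
have -> : residue_poly z (fun i => (e i)%:R - (f i)%:R)
        = residue_poly z (fun i => (e i)%:R)
          - residue_poly z (fun i => (f i)%:R).
  by rewrite /residue_poly -sumrB; apply: eq_bigr => i _; rewrite scalerBl.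
have dP : P^`() * pole_poly z = P * _ := deriv_node_poly _ _ z e.
have dQ : Q^`() * pole_poly z = Q * _ := deriv_node_poly _ _ z f.
by rewrite mulrBl mulrAC dP -(mulrA _ Q^`()) dQ; ring.
Qed.

Lemma pole_count_le (k : fieldType) (p r : nat) (z : 'I_r -> k)
    (e f : 'I_r -> nat) (n : nat) :
  p \in [pchar k] -> (\sum_i e i)%N = n -> (\sum_i f i)%N = n ->
  size (residue_poly z (fun i => (e i)%:R - (f i)%:R)) = 1%N ->
  (minn (r - 1) p <= n)%N.
Proof.
move=> pchark sum_e sum_f sz1.
rewrite geq_min; case: (leqP p n) => [_|ltnp]; first by rewrite orbT.
rewrite orbF; have /= := wronskian_node_poly k r z e f.
set P := node_poly _ e; set Q := node_poly _ f; set W := _ - _.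
set L := residue_poly _ _ => /= WR.
have [szP szQ] : size P = n.+1 /\ size Q = n.+1.
  by rewrite !size_node_poly sum_e sum_f.
have [P0 Q0] : P != 0 /\ Q != 0 by rewrite -!size_poly_gt0 szP szQ.
have L0 : L != 0 by rewrite -size_poly_gt0 sz1.
have WR0 : W * pole_poly z != 0 by rewrite WR !mulf_neq0.
have W0 : W != 0 by apply: contraNneq WR0 => ->; rewrite mul0r.
have R0 : pole_poly z != 0 by rewrite -size_poly_gt0 size_pole_poly.
have neqPQ : P != Q.
  by apply: contraNneq W0; rewrite /W => ->; rewrite mulrC subrr.
have := size_wronskian_monic _ _ _ _ _ pchark (monic_node_poly _ _ _ _)
  (monic_node_poly _ _ _ _) szP szQ ltnp neqPQ.
have := congr1 (fun g : {poly k} => size g) WR.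
(* Comparing sizes gives [size W + r = 2n + 1]; with [n <= size W] this yields [r - 1 <= n]. *)
rewrite /= !size_mul ?mulf_neq0 // szP szQ sz1 size_pole_poly.
by move: (size W) => w; lia.
Qed.

Lemma dvdz_biggcdz (I : eqType) (s : seq I) (A : I -> int) i :
  i \in s -> (\big[gcdz/0]_(j <- s) A j %| A i)%Z.
Proof.
elim: s => [//|j s IH]; rewrite in_cons big_cons => /orP[/eqP ->|/IH dvd_i].
  exact: dvdz_gcdl.
exact: dvdz_trans (dvdz_gcdr _ _) dvd_i.
Qed.

Lemma lift_k_ge0 r (A : 'I_r -> int) : 0 <= lift_k A.
Proof. by rewrite /lift_k; elim/big_rec: _. Qed.

Lemma natr_Fp_lift (k : fieldType) (p : nat) (x : 'F_p) (m : int) :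
  p \in [pchar k] -> m%:~R = x -> (x : nat)%:R = m%:~R :> k.
Proof.
move=> pchark mx; have p_pr := pcharf_prime pchark.
apply/eqP; rewrite eq_sym -subr_eq0 pmulrn -intrB -(dvdz_pcharf pchark).
rewrite (dvdz_pcharf (pchar_Fp p_pr)) intrB mx -[(_ : nat)%:~R]pmulrn.
by rewrite natr_Zp subrr.
Qed.

Theorem corollary4p2 (k : closedFieldType) (p : nat) (pchark : p \in [pchar k])
    (r : nat) (a : 'I_r -> 'F_p) (typea : is_type a)
    (exists_datum :
       exists omega : {fraction {poly k}}, good_deformation_datum a omega)
    (A : 'I_r -> int) (liftA : is_lift a A) :
  lift_k A * (minn (r - 1) p)%:Z <= lift_n A.
Proof.
have [r2 _ nz_a _] := typea; have [Aa sumA] := liftA.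
have [omega [al [be [ga [de [_ [[z inj_z ->] _ ord_le0]]]]]]] := exists_datum.
have aA i : (a i : nat)%:R = (A i)%:~R :> k by apply: natr_Fp_lift.
have nz_ak i : (a i : nat)%:R != 0 :> k.
  rewrite aA -(dvdz_pcharf pchark) (dvdz_pcharf (pchar_Fp (pcharf_prime pchark))).
  by rewrite Aa.
have szN : size (residue_poly z (fun i => (a i : nat)%:R)) = 1%N.
  by apply: residue_poly_const => //; apply: ltnW.
have K0 := lift_k_ge0 _ A; set K := lift_k A in K0 *.
pose B i := (A i %/ K)%Z.
have AB i : A i = K * B i.
  by rewrite mulrC divzK //; apply: dvdz_biggcdz; rewrite mem_index_enum.
(* A zero gcd would make every [A i], hence every residue, vanish; [r >= 2] supplies an index. *)
have Kn0 : K != 0.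
  apply: contraNneq (nz_ak (Ordinal (ltnW r2))) => K_eq0.
  by rewrite aA AB K_eq0 mul0r.
(* Positive and negative parts of [B]: the exponents in the numerator and denominator of the product
   of the (X - z i)^(B i). *)
pose e i := `|Num.max (B i) 0|%N; pose f i := `|Num.max (- B i) 0|%N.
have eZ i : (e i)%:Z = Num.max (B i) 0 by rewrite /e; lia.
have ef i : (e i)%:Z - (f i)%:Z = B i by rewrite /e /f; lia.
have sum_ef : (\sum_i e i)%N = (\sum_i f i)%N.
  apply/eqP; rewrite -eqz_nat -subr_eq0 -!natz !natr_sum -sumrB.
  apply/eqP/(mulfI Kn0); rewrite mulr0 mulr_sumr -[RHS]sumA.
  by apply: eq_bigr => i _; rewrite !natz ef -AB.
have lift_nE : lift_n A = K * (\sum_i e i)%N%:Z.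
  rewrite /lift_n -natz natr_sum mulr_sumr; apply: eq_bigr => i _.
  by rewrite natz eZ maxr_pMr // mulr0 -AB.
rewrite lift_nE ler_wpM2l // lez_nat.
apply: (@pole_count_le k p r z e f) => //.
have := szN; have -> : residue_poly z (fun i => (a i : nat)%:R)
  = K%:~R *: residue_poly z (fun i => (e i)%:R - (f i)%:R).
  rewrite /residue_poly scaler_sumr; apply: eq_bigr => i _.
  by rewrite scalerA aA AB -ef rmorphM rmorphB.
rewrite size_scale //.
(* [K] must also be nonzero in [k]: if [p] divided it, [p] would divide every [A i] and the residues
   would vanish. *)
apply: contraNneq (nz_ak (Ordinal (ltnW r2))) => K_eq0.
by rewrite aA AB rmorphM /= K_eq0 mul0r.
Qed.
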